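(* Let $n,d$ be positive integers with $1\le d<\frac{n-1}{2}$. The circuit distance power $C_n^{(d)}$ has eigenvalue $-3$ if and only if $6\mid n$ and $d\equiv 4 \pmod 6$. In this case, the multiplicity of the eigenvalue $-3$ equals two.
   Context: $C_n$ denotes the circuit (cycle) graph on $n$ vertices. For a graph $G$ and a positive integer $d$, the $d$-th distance power $G^{(d)}$ is the graph obtained from $G$ by adding edges between all pairs of distinct vertices whose distance in $G$ is at most $d$. The eigenvalues of a graph, and their multiplicities, are those of its adjacency matrix. The condition $1\le d<\frac{n-1}{2}$ expresses that $C_n^{(d)}$ is non-complete. *)

(* Defs.v *)
From HB Require Import structures.
From mathcomp Require Export all_boot all_order all_algebra.

(* A finite graph is given by its adjacency relation
   e : rel T on a finType T of vertices. *)

Set Implicit Arguments.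
Unset Strict Implicit.
Unset Printing Implicit Defensive.

Import GRing.Theory Num.Theory.

Section GraphDistance.

Variables (T : finType) (e : rel T).

Definition has_walk (k : nat) (x y : T) : bool :=
  [exists p : k.-tuple T, path e x p && (last x p == y)].

(* Two connected vertices are joined by a walk of length less than #|T|, so the
   search below returns the least length of a walk from x to y.  When x and y
   are not connected the search fails and the value is the junk value #|T|. *)
Definition gdist (x y : T) : nat :=
  find (fun k => has_walk k x y) (iota 0 #|T|).

(* The connectedness test discards the junk value of gdist: vertices in
   different components are at infinite distance. *)
Definition dist_power (d : nat) : rel T :=
  [rel x y | e x y || [&& x != y, connect e x y & (gdist x y <= d)%N]].

End GraphDistance.

(* ordS is the successor modulo n; for n < 3 this relation is not the
   adjacency relation of a circuit. *)
Definition circuit (n : nat) : rel 'I_n :=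
  [rel i j | (j == ordS i) || (i == ordS j)].

Definition adjacency_mx (R : pzRingType) (n : nat) (e : rel 'I_n) : 'M[R]_n :=
  (\matrix_(i < n, j < n) (e i j)%:R)%R.

(* Algebraic multiplicity; for the symmetric real matrices considered here it
   agrees with the dimension of the eigenspace. *)
Definition eigenvalue_mult (F : fieldType) (n : nat) (A : 'M[F]_n) (a : F) :
  nat := mup a (char_poly A).

(* Main.v *)
Require Import Defs.
From HB Require Import structures.
From mathcomp Require Import all_boot all_order all_algebra all_field.
From mathcomp Require Import zify ring.
Import Order.TTheory GRing.Theory Num.Theory.

(** The adjacency matrix of the circuit distance power is circulant: vertices
    at offset u are adjacent exactly when u or n - u lies between 1 and d.  The
    discrete Fourier transform therefore diagonalises it over the algebraic
    numbers, one eigenvalue lam z for each z with z ^+ n = 1, namely the sum of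
    the z ^+ u over those offsets, and the multiplicity of -3 is the number of
    z with lam z = -3 ([eigenvalue_mult_dist_power]).  Since the matrix has
    rational entries, multiplicities of rational eigenvalues do not depend on
    the field of characteristic zero ([eigenvalue_mult_adjacency_map]), so the
    count carries over to any real closed field.

    Summing the geometric series, lam z = -3 with z != 1 amounts to

      2 (1 - z) = z ^+ d.+1 - z ^+ (n - d).

    The right-hand side has absolute value at most 2, and this holds for every
    Galois conjugate of the equation.  Hence every conjugate 1 - z ^+ k of the
    nonzero algebraic integer 1 - z has absolute value at most 1, while their
    product is a nonzero integer; so all of them lie on the unit circle
    ([prim_root_unit_dist_one]).  As z and 1 - z both have absolute value 1, z
    is a root of X^2 - X + 1, that is, a primitive sixth root of unity, whence
    6 divides n.  For such z the number lam z depends only on d modulo 6 and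
    equals -3 in the single class of 4 ([dist_power_eigenvalue_root6]).  When 6
    divides n both roots of X^2 - X + 1 are n-th roots of unity, so the
    multiplicity is two. *)

Set Implicit Arguments.
Unset Strict Implicit.
Unset Printing Implicit Defensive.

(** * Distances and walks *)

Lemma has_walkP (T : finType) (e : rel T) k x y :
  reflect (exists p : seq T, [/\ size p = k, path e x p & last x p = y])
          (has_walk e k x y).
Proof.
apply: (iffP existsP) => [[p /andP[xp /eqP <-]]|[p [sz_p xp <-]]].
  by exists p; rewrite size_tuple.
by exists (tcast sz_p (in_tuple p)); rewrite val_tcast xp eqxx.
Qed.

Lemma gdist_leP (T : finType) (e : rel T) d x y : (d < #|T|)%N ->
  reflect (exists2 k, (k <= d)%N & has_walk e k x y) (gdist e x y <= d)%N.
Proof.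
move=> lt_d; apply: (iffP idP) => [le_d|[k le_k wk]].
  have lt_g : (gdist e x y < #|T|)%N by apply: leq_ltn_trans lt_d.
  exists (gdist e x y) => //.
  have has_g : has (fun k => has_walk e k x y) (iota 0 #|T|).
    by rewrite has_find size_iota.
  by have := nth_find 0 has_g; rewrite nth_iota.
rewrite leqNgt; apply/negP => /(leq_ltn_trans le_k) lt_kg.
by have := before_find 0 lt_kg; rewrite nth_iota ?add0n ?wk ?(leq_ltn_trans le_k).
Qed.

(** * Adjacency in the distance powers of a circuit *)

(** The numbers a and b count the forward and backward steps; the congruence is
    written additively to stay clear of truncated subtraction. *)
Lemma circuit_path n (x : 'I_n) p : path (@circuit n) x p ->
  exists a b, (a + b = size p)%N /\ (last x p + b = x + a %[mod n])%N.
Proof.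
elim: p x => [|z p IHp] x /=; first by exists 0%N, 0%N.
case/andP=> /orP[/eqP z_def|/eqP x_def] /IHp[a [b [<- eq_ab]]].
  exists a.+1, b; split; first by rewrite addSn.
  by rewrite eq_ab z_def /= modnDml addSnnS.
exists a, b.+1; split; first by rewrite addnS.
by rewrite addnS -addn1 -modnDml eq_ab modnDml x_def /= modnDml addSn addn1.
Qed.

Lemma has_walk_circuit_succ n k (x y : 'I_n) :
  (y = x + k %[mod n])%N -> has_walk (@circuit n) k x y.
Proof.
move=> eq_y; apply/has_walkP; exists (traject (@ordS n) (ordS x) k).
split; first by rewrite size_traject.
  elim: k (x) {eq_y} => //= k IHk z; rewrite IHk andbT /circuit /=.
  by rewrite eqxx.
rewrite last_traject; apply: val_inj; rewrite /= -[RHS](@modn_small _ n) // eq_y.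
elim: k (x) {eq_y} => [|k IHk] z; first by rewrite addn0 modn_small.
by rewrite iterSr IHk modnDml addSnnS.
Qed.

Lemma has_walk_sym (T : finType) (e : rel T) k x y : symmetric e ->
  has_walk e k x y = has_walk e k y x.
Proof.
move=> e_sym; suff: forall u v, has_walk e k u v -> has_walk e k v u.
  by move=> imp; apply/idP/idP => /imp.
move=> u v /has_walkP[p [sz_p up <-]]; apply/has_walkP.
exists (rev (belast u p)); rewrite size_rev size_belast sz_p; split=> //.
  by rewrite rev_path; apply: sub_path up => a b; rewrite e_sym.
by case: p {sz_p up} => //= a p; rewrite rev_cons last_rcons.
Qed.

Lemma circuit_sym n : symmetric (@circuit n).
Proof. by move=> x y; rewrite /circuit /= orbC. Qed.

(** A walk of length at most d < n with a forward and b backward steps has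
    offset a - b modulo n, so the reachable offsets are those at most d
    when a >= b and those at least n - d when a < b. *)
Lemma dist_power_circuit n d (x y : 'I_n) u : (0 < d)%N -> (d < n)%N ->
    (u < n)%N -> (y = x + u %[mod n])%N ->
  dist_power (@circuit n) d x y = (0 < u <= d)%N || (n - d <= u)%N.
Proof.
move=> d_gt0 lt_dn lt_un eq_y.
have lt_d : (d < #|'I_n|)%N by rewrite card_ord; lia.
have mod_u v : (v < n)%N -> (u = v %[mod n])%N -> u = v.
  by move=> lt_v; rewrite !modn_small.
have eq_xy : (x == y) = (u == 0%N).
  have -> : (x == y) = (x == y %[mod n])%N by rewrite !modn_small.
  by rewrite eq_y -[X in X == _ %[mod _]]addn0 eqn_modDl !modn_small; lia.
apply/idP/idP => [xy|u_range].
  have [k le_kd wk] : exists2 k, (k <= d)%N & has_walk (@circuit n) k x y.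
    case/orP: xy => [xy|/and3P[_ _ /gdist_leP-/(_ lt_d)//]].
    by exists 1%N => //; apply/has_walkP; exists [:: y]; rewrite /= xy.
  have u_neq0 : u != 0%N.
    rewrite -eq_xy; case/orP: xy => [xy|/and3P[]//].
    apply: contraTneq xy => <-; rewrite /circuit /= orbb -val_eqE /= neq_ltn.
    have [lt_x|ge_x] := ltnP x.+1 n; first by rewrite modn_small ?ltnSn.
    have -> : x.+1 = n by apply/eqP; rewrite eqn_leq ge_x ltn_ord.
    by rewrite modnn; apply/orP; right; move: (ltn_ord x); lia.
  have /has_walkP[p [sz_p /circuit_path[a [b [ab_p eq_ab]]] last_y]] := wk.
  have eq_u : (u + b = a %[mod n])%N.
    apply/eqP; rewrite -(eqn_modDl x) addnA -modnDml -eq_y modnDml -last_y.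
    exact/eqP.
  have le_abd : (a + b <= d)%N by rewrite ab_p sz_p.
  have [le_ba|lt_ab] := leqP b a.
    have u_def : u = (a - b)%N.
      apply: mod_u; first by clear - le_abd lt_dn; lia.
      by apply/eqP; rewrite -(eqn_modDr b) subnK // eq_u.
    by clear - u_def u_neq0 le_abd; lia.
  have u_def : u = (n - (b - a))%N.
    apply: mod_u; first by clear - lt_ab le_abd lt_dn; lia.
    apply/eqP; rewrite -(eqn_modDr b) eq_u.
    have -> : (n - (b - a) + b = n + a)%N by clear - lt_ab le_abd lt_dn; lia.
    by rewrite modnDl.
  by clear - u_def le_abd lt_ab; lia.
have u_neq0 : u != 0%N by lia.
have [k [k_gt0 le_kd wk]] :
    exists k, [/\ (0 < k)%N, (k <= d)%N & has_walk (@circuit n) k x y].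
  case/orP: u_range => u_range.
    by exists u; split; [lia | lia | apply: has_walk_circuit_succ].
  exists (n - u)%N; split; [lia | lia |].
  rewrite has_walk_sym; last exact: circuit_sym.
  apply: has_walk_circuit_succ; rewrite -modnDml eq_y modnDml -addnA subnKC.
    by rewrite modnDr.
  exact: ltnW.
apply/orP; right; rewrite eq_xy u_neq0 /=; apply/andP; split.
  by have /has_walkP[p [_ xp <-]] := wk; apply/connectP; exists p.
by apply/gdist_leP => //; exists k.
Qed.

(** * Characteristic polynomials and change of field *)

Local Open Scope ring_scope.

Lemma adjacency_mx_map (R S : pzRingType) (f : {rmorphism R -> S}) n (e : rel 'I_n) :
  map_mx f (adjacency_mx R e) = adjacency_mx S e.
Proof. by apply/matrixP => i j; rewrite !mxE rmorph_nat. Qed.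

Lemma mup_map (F K : fieldType) (f : {rmorphism F -> K}) (a : F) (p : {poly F}) :
  p != 0 -> mup (f a) (map_poly f p) = mup a p.
Proof.
move=> p_neq0; have fp_neq0 : map_poly f p != 0 by rewrite map_poly_eq0.
have eq_geq k : (k <= mup (f a) (map_poly f p))%N = (k <= mup a p)%N.
  by rewrite !mup_geq // -(dvdp_map f) rmorphXn /= rmorphB /= map_polyX map_polyC.
by apply/eqP; rewrite eqn_leq eq_geq leqnn -eq_geq leqnn.
Qed.

Lemma eigenvalue_mult_adjacency_map (F K : fieldType) (f : {rmorphism F -> K})
    n (e : rel 'I_n) a :
  eigenvalue_mult (adjacency_mx K e) (f a) = eigenvalue_mult (adjacency_mx F e) a.
Proof.
rewrite /eigenvalue_mult -(adjacency_mx_map f) -map_char_poly mup_map //.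
exact/monic_neq0/char_poly_monic.
Qed.

Lemma eigenvalue_mup (F : fieldType) n (A : 'M[F]_n) a :
  eigenvalue A a = (0 < eigenvalue_mult A a)%N.
Proof.
rewrite eigenvalue_root_char /eigenvalue_mult -XsubC_dvd ?dvdp_XsubCl //.
exact/monic_neq0/char_poly_monic.
Qed.

(** The intertwining relation extends to the characteristic matrices, since the
    scalar 'X commutes with V; taking determinants, det V is a nonzero constant
    and cancels. *)
Lemma char_poly_diagonalization (F : fieldType) n (A V : 'M[F]_n) (D : 'rV_n) :
    V \in unitmx -> A *m V = V *m diag_mx D ->
  char_poly A = \prod_(i < n) ('X - (D 0 i)%:P).
Proof.
move=> V_unit AV; have -> : char_poly A = char_poly (diag_mx D).
  have V_det : (\det V)%:P != 0 by rewrite polyC_eq0 -unitfE -unitmxE.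
  apply: (mulIf V_det); rewrite -det_map_mx /= /char_poly -det_mulmx mulrC.
  rewrite -det_mulmx /char_poly_mx mulmxBl mulmxBr -!map_mxM AV.
  by rewrite scalar_mxC.
rewrite char_poly_trig; first by apply: eq_bigr => i _; rewrite !mxE eqxx.
by apply/is_trig_mxP => i j lt_ij; rewrite !mxE -val_eqE /= ltn_eqF.
Qed.

(** * Spectrum of the circuit distance power *)

Definition dist_power_eigenvalue (F : pzRingType) n d (z : F) : F :=
  \sum_(1 <= k < d.+1) z ^+ k + \sum_(n - d <= k < n) z ^+ k.

(** Reindexing the vertices by their offset from i turns the row sum into
    z ^+ i times a sum that no longer depends on i.  The bound 2 d < n makes the
    offsets up to d and those from n - d on disjoint. *)
Lemma adjacency_dist_powerM (F : fieldType) n d (z : F) (i : 'I_n) :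
    (0 < d)%N -> (2 * d < n)%N -> z ^+ n = 1 ->
  \sum_(j < n) adjacency_mx F (dist_power (@circuit n) d) i j * z ^+ j
    = z ^+ i * dist_power_eigenvalue n d z.
Proof.
move=> d_gt0 lt_dn zn1; have n_gt0 : (0 < n)%N by lia.
pose shift (u : 'I_n) : 'I_n := Ordinal (ltn_pmod (i + u) n_gt0).
have shift_inj : injective shift.
  move=> u v /(congr1 val)/= /eqP; rewrite eqn_modDl !modn_small // => /eqP.
  exact: val_inj.
rewrite (reindex_inj shift_inj) /=.
have -> : \sum_(u < n) adjacency_mx F (dist_power (@circuit n) d) i (shift u)
                       * z ^+ ((i + u) %% n)
        = z ^+ i * \sum_(u < n | (0 < u <= d)%N || (n - d <= u)%N) z ^+ u.
  rewrite [in RHS]big_mkcond mulr_sumr; apply: eq_bigr => u _.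
  rewrite mxE (dist_power_circuit (u := u)) ?modn_mod //; last by lia.
  rewrite expr_mod // exprD; case: ifP => _; first by rewrite mul1r.
  by rewrite mul0r mulr0.
congr (_ * _).
pose P u := ((0 < u <= d) || (n - d <= u))%N.
rewrite -(big_mkord P (fun k => z ^+ k)) /dist_power_eigenvalue.
rewrite (big_cat_nat (n := d.+1)) //=; last by lia.
congr (_ + _).
  rewrite big_ltn_cond // {1}/P /= ifF; last by lia.
  by rewrite big_nat_cond [RHS]big_nat_cond; apply: eq_bigl => k; rewrite /P; lia.
rewrite (big_cat_nat (n := (n - d)%N)) /=; [|lia|lia].
rewrite big_nat_cond big1 ?add0r => [|k]; last by rewrite /P; lia.
by rewrite big_nat_cond [RHS]big_nat_cond; apply: eq_bigl => k; rewrite /P; lia.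
Qed.

(** Multiplying by z - 1 makes both geometric sums telescope and avoids any
    division by z - 1. *)
Lemma dist_power_eigenvalueM (F : comPzRingType) n d (z : F) : (d < n)%N ->
  (z - 1) * dist_power_eigenvalue n d z
    = z ^+ d.+1 - z + (z ^+ n - z ^+ (n - d)).
Proof.
move=> lt_dn.
have geom a b : (a <= b)%N ->
    (z - 1) * \sum_(a <= k < b) z ^+ k = z ^+ b - z ^+ a.
  move=> le_ab; rewrite -(telescope_sumr _ le_ab) mulr_sumr.
  by apply: eq_bigr => k _; rewrite mulrBl mul1r exprS.
by rewrite /dist_power_eigenvalue mulrDr !geom ?leq_subr.
Qed.

(** The columns of the Vandermonde matrix of the w ^+ t are the Fourier basis;
    they are independent because the n powers of w are distinct. *)
Lemma eigenvalue_mult_dist_power (F : fieldType) n d (w : F) a :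
    n.-primitive_root w -> (0 < d)%N -> (2 * d < n)%N ->
  eigenvalue_mult (adjacency_mx F (dist_power (@circuit n) d)) a
    = #|[pred t : 'I_n | dist_power_eigenvalue n d (w ^+ t) == a]|.
Proof.
move=> w_prim d_gt0 lt_dn.
pose V : 'M[F]_n := Vandermonde n (\row_t w ^+ t).
pose D : 'rV[F]_n := \row_t dist_power_eigenvalue n d (w ^+ t).
have V_unit : V \in unitmx.
  rewrite unitmxE unitfE det_Vandermonde; apply/prodf_neq0 => i _.
  apply/prodf_neq0 => j lt_ij; rewrite !mxE subr_eq0 (eq_prim_root_expr w_prim).
  by rewrite !modn_small // neq_ltn lt_ij orbT.
have AV : adjacency_mx F (dist_power (@circuit n) d) *m V = V *m diag_mx D.
  apply/matrixP => i t; rewrite mul_mx_diag !mxE -adjacency_dist_powerM //.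
    by apply: eq_bigr => j _; congr (_ * _); rewrite mxE [in RHS]/= mxE.
  by rewrite -exprM mulnC exprM (prim_expr_order w_prim) expr1n.
rewrite /eigenvalue_mult (char_poly_diagonalization V_unit AV).
rewrite -(big_map (fun t => D 0 t) xpredT (fun x => 'X - x%:P)) mu_prod_XsubC.
rewrite count_map -sum1_count -sum1_card.
by apply: eq_bigl => t /=; rewrite inE mxE.
Qed.

(** * Roots of unity giving the eigenvalue -3 *)

(** Kronecker's argument: the m-th cyclotomic polynomial takes at 1 a nonzero
    integer value, which is the product of the 1 - z ^+ k for k coprime to m.  No
    factor can be smaller than 1 in absolute value if none is larger.  Then z and 1 - z both
    have norm 1, which forces z + z^* = 1 and z * z^* = 1. *)
Lemma prim_root_unit_dist_one (m : nat) (z : algC) :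
    m.-primitive_root z -> (1 < m)%N ->
    (forall k, coprime k m -> `|1 - z ^+ k| <= 1) ->
  z ^+ 2 - z + 1 = 0.
Proof.
move=> z_prim m_gt1 conj_le1.
have z_norm : `|z| = 1.
  apply/eqP; rewrite -(@pexpr_eq1 _ _ m) ?normr_ge0 //; last by lia.
  by rewrite -normrX (prim_expr_order z_prim) normr1.
have z_norm1 : `|1 - z| = 1.
  apply/eqP; rewrite eq_le; apply/andP; split.
    by rewrite -[z]expr1 conj_le1 // coprime1n.
  pose N := (cyclotomic z m).[1].
  have N_int : N \in Num.int.
    rewrite /N -(Cintr_Cyclotomic z_prim).
    rewrite -[1 in X in X \in _](rmorph1 (intr : int -> algC)).
    by rewrite horner_map rpred_int.
  have N_prod : N = \prod_(k < m | coprime k m) (1 - z ^+ k).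
    by rewrite /N horner_prod; apply: eq_bigr => k _; rewrite !hornerE.
  have N_neq0 : N != 0.
    rewrite N_prod; apply/prodf_neq0 => k co_km; rewrite subr_eq0 eq_sym.
    rewrite -(expr0 z) (eq_prim_root_expr z_prim) mod0n modn_small //.
    by apply: contraTneq co_km => ->; rewrite /coprime gcd0n neq_ltn m_gt1 orbT.
  apply: le_trans (norm_intr_ge1 N_int N_neq0) _.
  rewrite N_prod normr_prod (bigD1 (Ordinal m_gt1)) /= ?coprime1n // expr1.
  rewrite ler_piMr ?normr_ge0 // prodr_ile1 // => k /andP[co_km _].
  by rewrite normr_ge0 conj_le1.
have zzC : z * z^* = 1 by rewrite -normCK z_norm expr1n.
have := normCK (1 - z); rewrite z_norm1 expr1n rmorphB rmorph1 /= => eq1.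
have zC : z + z^* = 1.
  rewrite (_ : z + z^* = 1 + z * z^* - (1 - z) * (1 - z^*)); last by ring.
  by rewrite zzC -eq1 addrK.
by rewrite -zzC -{2}[z]mulr1 -zC; ring.
Qed.

(** The bound on the conjugates required by Kronecker's argument: an
    automorphism of the algebraic numbers that raises z to the power k carries
    2 (1 - z) = z ^+ d.+1 - z ^+ (n - d) to the same equation for z ^+ k, whose
    right-hand side is a difference of two numbers of norm 1. *)
Lemma dist_power_eigenvalueN3_root n d (z : algC) :
    z ^+ n = 1 -> (0 < n)%N -> (0 < d)%N -> (d < n)%N ->
    dist_power_eigenvalue n d z = - 3%:R ->
  z ^+ 2 - z + 1 = 0.
Proof.
move=> zn1 n_gt0 d_gt0 lt_dn lam; have [m z_prim _] := prim_order_exists n_gt0 zn1.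
(* At z = 1 the sum is 2 d, so z is not 1. *)
have m_gt1 : (1 < m)%N.
  have m_gt0 := prim_order_gt0 z_prim.
  suff : m != 1%N by lia.
  apply: contra_eq_neq lam => m1.
  have := prim_expr_order z_prim; rewrite m1 expr1 => ->.
  rewrite /dist_power_eigenvalue.
  under eq_bigr do rewrite expr1n.
  under [X in _ + X]eq_bigr do rewrite expr1n.
  rewrite -subr_eq0 opprK !sumr_const_nat -!natrD pnatr_eq0; lia.
apply: (prim_root_unit_dist_one z_prim m_gt1) => k co_km.
have [u u_z] := Qn_aut_exists co_km.
have u_zk : u z = z ^+ k by apply/u_z/prim_expr_order.
have eqz : 2%:R * (1 - z) = z ^+ d.+1 - z ^+ (n - d).
  have := dist_power_eigenvalueM z lt_dn; rewrite lam zn1 => eqz.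
  have -> : z ^+ d.+1 - z ^+ (n - d) = (z ^+ d.+1 - z + (1 - z ^+ (n - d))) + z - 1.
    by ring.
  by rewrite -eqz; ring.
have z_norm : `|z| = 1.
  apply/eqP; rewrite -(@pexpr_eq1 _ _ n) ?normr_ge0 // -normrX zn1 normr1 //.
have := congr1 u eqz; rewrite rmorphM rmorph_nat !rmorphB rmorph1 !rmorphXn /= u_zk.
move/(congr1 Num.norm); rewrite normrM normr_nat => eq_norm.
rewrite -(ler_pM2l (ltr0Sn _ 1)) eq_norm mulr1.
apply: le_trans (ler_normB _ _) _.
by rewrite !normrX z_norm !expr1n.
Qed.

(** The polynomial X^2 - X + 1 is the sixth cyclotomic polynomial.  It divides
    X^6 - 1 with cofactor (X^3 - 1) (X + 1), and X^3 + 1 with cofactor X + 1, so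
    the order of a root divides 6 but not 3; if it divided 2 the root would be 2,
    which has order 2 in characteristic 3 only. *)
Lemma prim_root6P (F : numFieldType) (z : F) :
  reflect (z ^+ 2 - z + 1 = 0) (6.-primitive_root z).
Proof.
have X6_fact : z ^+ 6 - 1 = (z ^+ 3 - 1) * (z + 1) * (z ^+ 2 - z + 1) by ring.
apply: (iffP idP) => [z_prim|eq0].
  have /eqP := prim_expr_order z_prim; rewrite -subr_eq0 X6_fact mulf_eq0.
  case/orP=> [|/eqP //]; rewrite mulf_eq0 subr_eq0 addr_eq0.
  case/orP=> /eqP eqz; first by have := prim_order_dvd z_prim 3; rewrite eqz eqxx.
  by have := prim_order_dvd z_prim 2; rewrite eqz sqrrN expr1n eqxx.
have z6 : z ^+ 6 = 1 by apply/eqP; rewrite -subr_eq0 X6_fact eq0 mulr0.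
have [m z_prim m_dv6] := prim_order_exists (isT : (0 < 6)%N) z6.
have z3 : z ^+ 3 = -1.
  apply/eqP; rewrite -addr_eq0.
  by rewrite (_ : _ + 1 = (z + 1) * (z ^+ 2 - z + 1)); [rewrite eq0 mulr0 | ring].
have [<-//|m6] := eqVneq m 6%N.
have : (m %| 2)%N || (m %| 3)%N by case: m m_dv6 m6 {z_prim} => [|[|[|[|[|[|[|[]]]]]]]].
rewrite !(prim_order_dvd z_prim) z3 => /orP[] /eqP eqz.
  have z2 : z = 2%:R by apply/eqP; rewrite -subr_eq0 -oppr_eq0 -eq0 eqz; apply/eqP; ring.
  by have /eqP := eqz; rewrite z2 -natrX -[1]/(1%:R) eqr_nat.
by have /eqP := eqz; rewrite eq_sym -addr_eq0 -[1 + 1]/(2%:R) pnatr_eq0.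
Qed.

(** As z ^+ 6 = 1 and z ^+ 2 = z - 1, the eigenvalue plus 3, multiplied by
    z - 1, is an integer multiple of z - 1; the multiples for d = 0, ..., 5
    modulo 6 are 3, 4, 3, 1, 0, 1. *)
Lemma dist_power_eigenvalue_root6 (F : numFieldType) n d (z : F) :
    z ^+ 2 - z + 1 = 0 -> z ^+ n = 1 -> (d < n)%N ->
  (dist_power_eigenvalue n d z == - 3%:R) = (d == 4 %[mod 6])%N.
Proof.
move=> eq0 zn1 lt_dn.
have z_neq1 : z - 1 != 0.
  by apply: contra_eq_neq eq0 => /eqP; rewrite subr_eq0 => /eqP ->;
     rewrite expr1n subrr add0r oner_neq0.
have z6 := prim_expr_order (introT (prim_root6P _) eq0).
have zd : z ^+ (n - d) = z ^+ (6 - d %% 6).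
  have z_neq0 : z != 0.
    by apply: contra_eq_neq z6 => ->; rewrite expr0n eq_sym oner_neq0.
  apply: (mulIf (expf_neq0 d z_neq0)).
  rewrite -exprD subnK ?(ltnW lt_dn) // zn1 -[z ^+ d in RHS](expr_mod _ z6).
  by rewrite -exprD subnK ?z6 // ltnW // ltn_pmod.
have zd1 : z ^+ d.+1 = z ^+ (d %% 6).+1 by rewrite exprS -(expr_mod d z6) -exprS.
have z2 : z ^+ 2 = z - 1 by apply/eqP; rewrite -subr_eq0 -eq0; apply/eqP; ring.
rewrite -(inj_eq (mulfI z_neq1)) (dist_power_eigenvalueM _ lt_dn) zn1 zd zd1.
rewrite -subr_eq0.
have z3 : z ^+ 3 = -1 by rewrite exprS z2 mulrBr -expr2 z2; ring.
have z4 : z ^+ 4 = - z by rewrite exprS z3; ring.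
have z5 : z ^+ 5 = 1 - z by rewrite exprS z4 mulrN -expr2 z2; ring.
have lt6 : (d %% 6 < 6)%N by rewrite ltn_pmod.
have mulz_eq0 c : c%:R * (z - 1) == 0 = (c == 0%N).
  by rewrite mulf_eq0 (negbTE z_neq1) orbF pnatr_eq0.
case: (d %% 6)%N lt6 => [|[|[|[|[|[|r]]]]]] //= _;
  rewrite ?subSS ?subn0 ?expr1 ?z2 ?z3 ?z4 ?z5 ?z6.
- by rewrite -[RHS]/(3%N == 0%N) -mulz_eq0; congr (_ == 0); ring.
- by rewrite -[RHS]/(4%N == 0%N) -mulz_eq0; congr (_ == 0); ring.
- by rewrite -[RHS]/(3%N == 0%N) -mulz_eq0; congr (_ == 0); ring.
- by rewrite -[RHS]/(1%N == 0%N) -mulz_eq0; congr (_ == 0); ring.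
- by rewrite -[RHS]/(0%N == 0%N) -mulz_eq0; congr (_ == 0); ring.
by rewrite -[RHS]/(1%N == 0%N) -mulz_eq0; congr (_ == 0); ring.
Qed.

Lemma card_prim_root6 (F : numFieldType) n (w : F) : n.-primitive_root w -> (6 %| n)%N ->
  #|[pred t : 'I_n | (w ^+ t) ^+ 2 - w ^+ t + 1 == 0]| = 2.
Proof.
move=> w_prim n6; have n_gt0 := prim_order_gt0 w_prim.
have [m n_def] := dvdnP n6.
have lt1 : (m < n)%N by lia.
have lt5 : (5 * m < n)%N by lia.
(* The two roots of X^2 - X + 1 are v = w ^+ m and 1 - v = v ^+ 5. *)
have v_prim : 6.-primitive_root (w ^+ m).
  by have := dvdn_prim_root w_prim n6; rewrite n_def mulnK.
have v0 := elimT (prim_root6P _) v_prim.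
set v := w ^+ m in v_prim v0.
have v5 : v ^+ 5 = 1 - v.
  apply/eqP; rewrite -subr_eq0 (_ : _ - _ = (v ^+ 3 + v ^+ 2 - 1) * (v ^+ 2 - v + 1)).
    by rewrite v0 mulr0.
  by ring.
rewrite (@eq_card _ _ (pred2 (Ordinal lt1) (Ordinal lt5))) => [|t].
  by rewrite card2 -val_eqE /=; lia.
rewrite !inE -!val_eqE /=.
rewrite (_ : _ + 1 = (w ^+ t - v) * (w ^+ t - (1 - v))); last first.
  by rewrite -[LHS]subr0 -v0; ring.
rewrite mulf_eq0 !subr_eq0 -v5 -exprM mulnC !(eq_prim_root_expr w_prim).
by rewrite !modn_small.
Qed.

Lemma dist_power_eigenvalueN3P n d (z : algC) :
    z ^+ n = 1 -> (0 < n)%N -> (0 < d)%N -> (d < n)%N ->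
  (dist_power_eigenvalue n d z == - 3%:R)
    = (z ^+ 2 - z + 1 == 0) && (d == 4 %[mod 6])%N.
Proof.
move=> zn1 n_gt0 d_gt0 lt_dn; apply/idP/andP => [lam|[/eqP z0 d4]].
  have z0 := dist_power_eigenvalueN3_root zn1 n_gt0 d_gt0 lt_dn (eqP lam).
  by rewrite z0 eqxx -(dist_power_eigenvalue_root6 z0 zn1).
by rewrite dist_power_eigenvalue_root6.
Qed.

Lemma eigenvalue_multN3_algC n d : (0 < d)%N -> (2 * d < n)%N ->
  eigenvalue_mult (adjacency_mx algC (dist_power (@circuit n) d)) (- 3%:R)
    = if (6 %| n)%N && (d == 4 %[mod 6])%N then 2 else 0%N.
Proof.
move=> d_gt0 lt_dn; have n_gt0 : (0 < n)%N by lia.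
have [w w_prim] := C_prim_root_exists n_gt0.
rewrite (eigenvalue_mult_dist_power _ w_prim) //.
have lamP (t : 'I_n) : (dist_power_eigenvalue n d (w ^+ t) == - 3%:R)
    = ((w ^+ t) ^+ 2 - w ^+ t + 1 == 0) && (d == 4 %[mod 6])%N.
  apply: dist_power_eigenvalueN3P => //; last by lia.
  by rewrite -exprM mulnC exprM (prim_expr_order w_prim) expr1n.
rewrite (eq_card (B := [pred t : 'I_n | ((w ^+ t) ^+ 2 - w ^+ t + 1 == 0)
                                        && (d == 4 %[mod 6])%N])); last first.
  by move=> t; rewrite !inE.
have [n6|nN6] := boolP (6 %| n)%N.
  case: ifP => [/= -> | /= ->].
    by rewrite -(card_prim_root6 w_prim n6); apply: eq_card => t; rewrite !inE andbT.
  by apply: eq_card0 => t; rewrite !inE andbF.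
apply: eq_card0 => t; rewrite !inE; apply/negP => /andP[/eqP /prim_root6P z_prim _].
case/negP: nN6; rewrite (prim_order_dvd z_prim) -exprM mulnC exprM.
by rewrite (prim_expr_order w_prim) expr1n.
Qed.

Theorem theorem9 (R : rcfType) (n d : nat)
    (hn : (0 < n)%N) (hd : (1 <= d)%N) (hdn : (2 * d < n - 1)%N) :
  let A : 'M[R]_n := adjacency_mx R (dist_power (@circuit n) d) in
  (eigenvalue A (- 3%:R)%R <-> (6 %| n)%N /\ (d = 4 %[mod 6])%N) /\
  ((6 %| n)%N /\ (d = 4 %[mod 6])%N -> eigenvalue_mult A (- 3%:R)%R = 2).
Proof.
move=> A.
have multA : eigenvalue_mult A (- 3%:R)
    = if (6 %| n)%N && (d == 4 %[mod 6])%N then 2 else 0%N.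
  rewrite -eigenvalue_multN3_algC //; last by lia.
  (* Both multiplicities equal that of the same matrix over the rationals. *)
  have <- : ratr (- 3%:R) = - 3%:R :> R by rewrite rmorphN rmorph_nat.
  have <- : ratr (- 3%:R) = - 3%:R :> algC by rewrite rmorphN rmorph_nat.
  by rewrite !eigenvalue_mult_adjacency_map.
rewrite eigenvalue_mup multA; split; last by case=> -> /eqP ->.
split; first by case: andP => // -[n6 /eqP d4].
by case=> -> /eqP ->.
Qed.
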